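(* For the cone metric $g_r$ on $\mathfrak{H}\times\mathbb{R}_{>0}$, the (normalized) Ricci curvatures in the directions of $X_r,Y_r,T_r,\partial_r$ are respectively $$\mathrm{Ric}(X_r)=\mathrm{Ric}(Y_r)=-\frac{4}{3r^2},\qquad \mathrm{Ric}(T_r)=\mathrm{Ric}(\partial_r)=0,$$ and the (normalized) scalar curvature is $$K=-\frac{2}{3r^2}.$$
   Context: $\mathfrak{H}=\mathbb{C}\times\mathbb{R}$ is the Heisenberg group with coordinates $(z=x+iy,t)$ and multiplication $(z,t)*(w,s)=(z+w,t+s+2\Im(z\overline w))$. Put $X=\partial_x+2y\,\partial_t$, $Y=\partial_y-2x\,\partial_t$, $T=\partial_t$, $\widetilde T=2T$, $\omega=dt+2x\,dy-2y\,dx$, $g=dx^2+dy^2+\tfrac14\omega^2$. On $\mathfrak{H}\times\mathbb{R}_{>0}$, with coordinate $r$ on the second factor, $g_r=dr^2+r^2g$, with orthonormal frame $X_r=\tfrac1rX$, $Y_r=\tfrac1rY$, $T_r=\tfrac1r\widetilde T$, $\partial_r=d/dr$. Normalization: on an $n$-dimensional Riemannian manifold (here $n=4$), for a unit vector $e_1$ completed to an orthonormal basis $e_1,\dots,e_n$, $\mathrm{Ric}(e_1)=\frac{1}{n-1}\sum_{j\ge2}K(e_1,e_j)$ with $K(e_i,e_j)$ the sectional curvature, and the scalar curvature is $\frac1n\sum_{j=1}^n\mathrm{Ric}(e_j)$. *)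

(* Defs.v *)
From mathcomp Require Import all_boot all_order all_algebra.
From mathcomp Require Import all_classical all_reals all_analysis.

Set Implicit Arguments.
Unset Strict Implicit.
Unset Printing Implicit Defensive.

Import Order.TTheory GRing.Theory Num.Theory numFieldNormedType.Exports.

Local Open Scope ring_scope.

(* A manifold covered by one global chart is given by its metric
   [g : 'rV_n -> 'M_n] in that chart: [g p] is the Gram matrix of the coordinate
   fields at [p], and tangent vectors and covectors are row vectors of components.
   Curvature at [p] depends only on the germ of [g] at [p], so the values of [g]
   outside the chart domain are irrelevant. *)

Section RiemannianGeometry.
Context {R : realType} {n : nat}.
Implicit Types (g : 'rV[R]_n -> 'M[R]_n) (p u v w : 'rV[R]_n) (e : 'M[R]_n).

Definition partial_deriv (i : 'I_n) (f : 'rV[R]_n -> R) p : R :=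
  'D_(delta_mx 0 i : 'rV[R]_n) f p.

Definition inner g p u v : R := (u *m g p *m v^T) 0 0.

(* Levi-Civita connection: nabla_i d_j = \sum_k (christoffel g k i j) d_k. *)
Definition christoffel g (k i j : 'I_n) p : R :=
  2^-1 * \sum_(l < n) invmx (g p) k l *
    (partial_deriv i (fun q => g q j l) p
     + partial_deriv j (fun q => g q i l) p
     - partial_deriv l (fun q => g q i j) p).

(* R(d_i, d_j) d_k = \sum_l (riemann_coef g l k i j) d_l, with
   R(U, V) = nabla_U nabla_V - nabla_V nabla_U - nabla_[U, V]. *)
Definition riemann_coef g (l k i j : 'I_n) p : R :=
  partial_deriv i (christoffel g l j k) p
  - partial_deriv j (christoffel g l i k) p
  + \sum_(m < n) (christoffel g l i m p * christoffel g m j k p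
                  - christoffel g l j m p * christoffel g m i k p).

Definition riemann g p u v w : 'rV[R]_n :=
  \row_l \sum_(i < n) \sum_(j < n) \sum_(k < n)
    u 0 i * v 0 j * w 0 k * riemann_coef g l k i j p.

Definition sectional_curvature g p u v : R :=
  inner g p (riemann g p u v v) u
  / (inner g p u u * inner g p v v - inner g p u v ^+ 2).

(* The rows of [e] form an orthonormal basis of the tangent space at [p]. *)
Definition orthonormal_basis g p e : Prop :=
  forall i j : 'I_n, inner g p (row i e) (row j e) = (i == j)%:R.

(* [v] is a unit vector whose normalized Ricci curvature is [rho]: [v] can be
   completed to an orthonormal basis, and every such completion yields [rho].
   The position of [v] in the basis is left free. *)
Definition has_ricci g p v (rho : R) : Prop :=
  (exists e (i : 'I_n), orthonormal_basis g p e /\ row i e = v) /\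
  (forall e (i : 'I_n), orthonormal_basis g p e -> row i e = v ->
     rho = (n%:R - 1)^-1 *
           \sum_(j < n | j != i) sectional_curvature g p v (row j e)).

(* Orthonormal bases exist, and each of them yields the normalized scalar
   curvature [K]. *)
Definition has_scalar g p (K : R) : Prop :=
  (exists e, orthonormal_basis g p e) /\
  (forall e, orthonormal_basis g p e ->
     exists rho : 'I_n -> R,
       (forall j, has_ricci g p (row j e) (rho j)) /\
       K = n%:R^-1 * \sum_(j < n) rho j).

End RiemannianGeometry.

(* The metric dr^2 + r^2 g on N x R_{>0}; the last coordinate is r. *)
Definition cone_metric {R : realType} {n : nat} (g : 'rV[R]_n -> 'M[R]_n)
    (p : 'rV[R]_(n + 1)) : 'M[R]_(n + 1) :=
  let r := rsubmx p 0 0 in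
  block_mx (r ^+ 2 *: g (lsubmx p)) 0 0 1%:M.

Definition cone_point {R : realType} {n : nat} (h : 'rV[R]_n) (r : R) :
  'rV[R]_(n + 1) := row_mx h r%:M.

Section Heisenberg.
Context {R : realType}.
Implicit Types (h : 'rV[R]_3) (r : R).

(* The Heisenberg group C x R in the real coordinates (x, y, t) of (x + iy, t). *)
Definition cx h : R := h 0 (inord 0).
Definition cy h : R := h 0 (inord 1).

Definition d_x : 'rV[R]_3 := delta_mx 0 (inord 0).
Definition d_y : 'rV[R]_3 := delta_mx 0 (inord 1).
Definition d_t : 'rV[R]_3 := delta_mx 0 (inord 2).

Definition X h : 'rV[R]_3 := d_x + (2 * cy h) *: d_t.
Definition Y h : 'rV[R]_3 := d_y - (2 * cx h) *: d_t.
Definition T h : 'rV[R]_3 := d_t.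
Definition Ttilde h : 'rV[R]_3 := 2 *: T h.

(* The dual coordinate basis: a covector [a] acts on [v] by [a *m v^T]. *)
Definition dx : 'rV[R]_3 := delta_mx 0 (inord 0).
Definition dy : 'rV[R]_3 := delta_mx 0 (inord 1).
Definition dt : 'rV[R]_3 := delta_mx 0 (inord 2).

Definition omega h : 'rV[R]_3 := dt + (2 * cx h) *: dy - (2 * cy h) *: dx.

(* The symmetric bilinear form a^2 : (u, v) |-> a(u) a(v). *)
Definition covector_sq (a : 'rV[R]_3) : 'M[R]_3 := a^T *m a.

Definition heis_metric h : 'M[R]_3 :=
  covector_sq dx + covector_sq dy + 4^-1 *: covector_sq (omega h).

Definition cone_lift (v : 'rV[R]_3) r : 'rV[R]_(3 + 1) := row_mx (r^-1 *: v) 0.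

Definition X_r h r := cone_lift (X h) r.
Definition Y_r h r := cone_lift (Y h) r.
Definition T_r h r := cone_lift (Ttilde h) r.
Definition d_r : 'rV[R]_(3 + 1) := row_mx 0 1%:M.

End Heisenberg.

(* Main.v *)
Require Import Defs.
From mathcomp Require Import all_boot all_order all_algebra ring.
From mathcomp Require Import all_classical all_reals all_analysis.
Import Order.TTheory GRing.Theory Num.Theory numFieldNormedType.Exports.
Local Open Scope ring_scope.

(** The whole curvature of the cone lives in the plane of [X_r] and [Y_r], and
    the Ricci and scalar curvatures only measure projections to that plane.

    For any metric [g] on the base, the Christoffel symbols of [dr^2 + r^2 g]
    give the Gauss type formula ([riemann_cone_quartic])
      [<R(U,V)V,U> = r^2 (<R_g(u,v)v,u> - (|u|^2 |v|^2 - <u,v>^2))],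
    where [u], [v] are the base components of [U], [V]: the base is compared
    with the unit sphere, whose cone is flat, and the radial direction
    contributes nothing.

    On the Heisenberg group the coordinate differential of the contact form
    [omega] is a constant antisymmetric form, so the metric
    [dx^2 + dy^2 + omega^2 / 4] has Christoffel symbols that are symmetrized
    products of [omega] with the map [X -> 2Y], [Y -> -2X]
    ([christoffel_heis]).  This gives
    ([riemann_heis_quartic]) sectional curvature [-3] on the horizontal plane
    and [1] on every plane containing the vertical direction.  Subtracting the
    constant [1] leaves [-4 (dx /\ dy)(u,v)^2] and nothing else
    ([riemann_heis_deviation]).

    Hence on the cone [<R(U,V)V,U>] is [k = - 4 / r^2] times the squared area of
    the projection of [U], [V] to the plane of [X_r], [Y_r]
    ([cone_heis_plane]).  For such a curvature, Parseval's identity makes the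
    sum of the sectional curvatures over the remaining vectors of an orthonormal
    basis equal to [k] times the squared length of the projection of the unit
    vector to that plane, whatever the basis is ([ricci_of_plane]); so the
    Ricci curvature is [k / 3] on [X_r], [Y_r] and [0] on [T_r], [d_r], and the
    squared lengths of the projections add up to [2] over any basis
    ([scalar_of_plane]). *)

(** * Derivatives and tensors in a global chart *)

Section GlobalChart.
Context {R : realType}.

(** A directional derivative only sees the restriction of the function to a
    line: both sides are limits of the same difference quotients. *)
Lemma derive_along {V W : normedModType R} (f : V -> R) (f' : W -> R)
    (p v : V) (q w : W) :
  (forall t : R, f (t *: v + p) = f' (t *: w + q)) -> 'D_v f p = 'D_w f' q.
Proof.
move=> ff'; rewrite /derive.
suff -> : (fun t : R => t^-1 *: ((f \o shift p) (t *: v) - f p)) =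
    (fun t : R => t^-1 *: ((f' \o shift q) (t *: w) - f' q)) by [].
apply/funext => t /=; rewrite ff'; congr (_ *: (_ - _)).
by have := ff' 0; rewrite !scale0r !add0r.
Qed.

Lemma partial_deriv_eq {N} (f f' : 'rV[R]_N -> R) (a : 'I_N) p : f =1 f' ->
  partial_deriv a f p = partial_deriv a f' p.
Proof. by move=> /funext ->. Qed.

Lemma partial_deriv_cst {N} (f : 'rV[R]_N -> R) (a : 'I_N) p :
  (forall q, f q = f p) -> partial_deriv a f p = 0.
Proof.
by move=> fp; rewrite (partial_deriv_eq _ (fun=> f p)) //; exact: derive_cst.
Qed.

(** The formulas for the cone hold off the apex only, which is enough to
    differentiate them along the ray. *)
Lemma derive_off_zero (f f' : R -> R) r : r != 0 ->
  (forall s, s != 0 -> f s = f' s) -> 'D_1 f r = 'D_1 f' r.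
Proof.
move=> r0 ff'; apply: near_eq_derive; near=> s; apply: ff'.
near: s; exact: (cvgr_neq0 _ cvg_id r0).
Unshelve. all: by end_near. Qed.

Lemma innerE {N} (f : 'rV[R]_N -> 'M[R]_N) q u v :
  inner f q u v = \sum_i \sum_j u 0 i * v 0 j * f q i j.
Proof.
rewrite /inner mxE exchange_big; apply: eq_bigr => j _ /=.
by rewrite !mxE mulr_suml; apply: eq_bigr => i _; rewrite mulrAC.
Qed.

Lemma innerBl {N} (f : 'rV[R]_N -> 'M[R]_N) q u v w :
  inner f q (u - v) w = inner f q u w - inner f q v w.
Proof. by rewrite /inner !mulmxBl !mxE. Qed.

Lemma innerZl {N} (f : 'rV[R]_N -> 'M[R]_N) q c u w :
  inner f q (c *: u) w = c * inner f q u w.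
Proof. by rewrite /inner -!scalemxAl mxE. Qed.

Lemma christoffelC {N} (f : 'rV[R]_N -> 'M[R]_N) (a b c : 'I_N) p :
  (forall q, (f q)^T = f q) -> christoffel f a b c p = christoffel f a c b p.
Proof.
move=> fT; rewrite /christoffel; congr (_ * _); apply: eq_bigr => d _.
congr (_ * (_ - _)); first exact: addrC.
by apply: partial_deriv_eq => q; rewrite -[in LHS]fT mxE.
Qed.

Lemma riemann_coefC {N} (f : 'rV[R]_N -> 'M[R]_N) (a b c d : 'I_N) q :
  riemann_coef f a b d c q = - riemann_coef f a b c d q.
Proof.
rewrite /riemann_coef [in RHS]opprD opprB; congr (_ + _).
by rewrite -sumrN; apply: eq_bigr => e _; rewrite opprB.
Qed.

End GlobalChart.

(** * Ricci and scalar curvature when the curvature lives in one plane *)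

Section CurvatureOfOnePlane.
Context {R : realType} {n : nat}.
Variables (g : 'rV[R]_n -> 'M[R]_n) (p : 'rV[R]_n).
Implicit Types (a b u v : 'rV[R]_n) (e : 'M[R]_n).

Lemma orthonormal_basisP e :
  orthonormal_basis g p e <-> e *m g p *m e^T = 1%:M.
Proof.
have entry i j : inner g p (row i e) (row j e) = (e *m g p *m e^T) i j.
  by rewrite /inner -!row_mul !mxE; apply: eq_bigr => k _; rewrite !mxE.
split=> [oe|oe i j]; last by rewrite entry oe mxE.
by apply/matrixP => i j; rewrite -entry oe mxE.
Qed.

(** [e g e^T = 1] says that [g e^T] is a right inverse of the square matrix [e],
    hence also a left one: this is the resolution of the identity. *)
Lemma parseval {e} a b : orthonormal_basis g p e ->
  \sum_j inner g p a (row j e) * inner g p (row j e) b = inner g p a b.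
Proof.
move/orthonormal_basisP; rewrite -mulmxA => /mulmx1C dual.
have -> : inner g p a b = ((a *m g p *m e^T) *m (e *m g p *m b^T)) 0 0.
  by rewrite /inner -{1}(mulmx1 a) -dual !mulmxA.
rewrite mxE; apply: eq_bigr => j _; congr (_ * _).
  by rewrite /inner !mxE; apply: eq_bigr => k _; rewrite !mxE.
by rewrite /inner -!row_mul mxE.
Qed.

Lemma innerC a b : (g p)^T = g p -> inner g p a b = inner g p b a.
Proof.
move=> gT; rewrite /inner -[RHS]trace_mx11 -mxtrace_tr trace_mx11.
by rewrite !trmx_mul trmxK gT mulmxA.
Qed.

(** For orthonormal [a], [b], the square is that of the area spanned by the
    projections of [u], [v] to the plane of [a], [b]: the curvature operator has
    rank one, with eigenvalue [k] on [a /\ b]. *)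
Definition curvature_in_plane a b (k : R) : Prop := forall u v,
  inner g p (riemann g p u v v) u =
  k * (inner g p u a * inner g p v b - inner g p v a * inner g p u b) ^+ 2.

Variables (e : 'M[R]_n) (s t : 'I_n) (k : R).
Hypotheses (gT : (g p)^T = g p) (e_on : orthonormal_basis g p e) (st : s != t).
Hypothesis plane : curvature_in_plane (row s e) (row t e) k.

(** Summing [(A <b,f_m> - B <a,f_m>)^2] over an orthonormal basis [f] gives
    [A^2 |b|^2 + B^2 |a|^2 - 2 A B <a,b>] by Parseval, independently of [f]. *)
Lemma ricci_of_plane {e'} i : orthonormal_basis g p e' ->
  has_ricci g p (row i e') ((n%:R - 1)^-1 *
    (k * (inner g p (row i e') (row s e) ^+ 2
          + inner g p (row i e') (row t e) ^+ 2))).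
Proof.
move=> e'_on; split; first by exists e', i.
move: (row i e') (e'_on i i) => v _ f j f_on fv; congr (_ * _).
have sec m : m != j -> sectional_curvature g p v (row m f) =
    inner g p (riemann g p v (row m f) (row m f)) v.
  move=> mj; rewrite /sectional_curvature -fv !f_on !eqxx eq_sym (negPf mj).
  by rewrite expr0n /= subr0 mulr1 divr1.
rewrite (eq_bigr _ sec).
(* The missing term, with [v] paired with itself, vanishes by antisymmetry. *)
have -> : \sum_(m | m != j) inner g p (riemann g p v (row m f) (row m f)) v =
    \sum_m inner g p (riemann g p v (row m f) (row m f)) v.
  rewrite [RHS](bigD1 j) //= fv plane [_ - _](_ : _ = 0) ?subrr //.
  by rewrite expr0n mulr0 add0r.
pose A := inner g p v (row s e); pose B := inner g p v (row t e).
rewrite -/A -/B.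
under eq_bigr => m _.
  rewrite plane -/A -/B (innerC (row m f)) // (innerC (row m f)) //.
  over.
rewrite -mulr_sumr; congr (_ * _).
have pars a b : \sum_m inner g p a (row m f) * inner g p b (row m f)
    = inner g p a b.
  rewrite -(parseval _ _ f_on); apply: eq_bigr => m _; congr (_ * _).
  exact: innerC.
(* The Kronecker symbols stand for inner products of frame vectors. *)
transitivity (A ^+ 2 * (t == t)%:R + B ^+ 2 * (s == s)%:R
              - 2 * A * B * (s == t)%:R).
  by rewrite !eqxx (negPf st) /=; ring.
rewrite -!e_on -!pars !mulr_sumr -big_split -sumrB /=.
by apply: eq_bigr => m _; ring.
Qed.

Lemma ricci_of_frame i : has_ricci g p (row i e)
  ((n%:R - 1)^-1 * (k * ((i == s) || (i == t))%:R)).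
Proof.
have := ricci_of_plane i e_on; rewrite !e_on.
congr has_ricci; congr (_ * (_ * _)).
have [->|_] := eqVneq i s; first by rewrite (negPf st) expr1n expr0n addr0.
by case: (i == t); rewrite expr0n ?expr1n add0r.
Qed.

(** The projections of an orthonormal basis to a plane have squared lengths of
    total [2], the dimension of the plane. *)
Lemma scalar_of_plane : has_scalar g p (n%:R^-1 * ((n%:R - 1)^-1 * (k * 2))).
Proof.
split; first by exists e.
move=> f f_on; eexists; split=> [j|]; first exact: ricci_of_plane j f_on.
rewrite -!mulr_sumr big_split /=; congr (_ * (_ * (_ * _))).
have unit_length m : \sum_j inner g p (row j f) (row m e) ^+ 2 = 1.
  transitivity (inner g p (row m e) (row m e)); last by rewrite e_on eqxx.
  rewrite -(parseval _ _ f_on); apply: eq_bigr => j _.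
  by rewrite (innerC (row m e)).
by rewrite !unit_length.
Qed.

End CurvatureOfOnePlane.

(** * Curvature of a metric cone *)

Section Cone.
Context {R : realType} {n : nat}.
Implicit Types (h u v w : 'rV[R]_n) (r : R) (i j k l m : 'I_n).

Let radial : 'I_(n + 1) := rshift n ord0.

Lemma cone_indexP (a : 'I_(n + 1)) : a = radial \/ exists i, a = lshift 1 i.
Proof.
case: (split_ordP a) => b ->; last by left; congr rshift; exact: ord1.
by right; exists b.
Qed.

Lemma partial_deriv_base (f : 'rV[R]_(n + 1) -> R) i h r :
  partial_deriv (lshift 1 i) f (cone_point h r) =
  partial_deriv i (fun h' => f (cone_point h' r)) h.
Proof.
apply: derive_along => t; congr f.
by rewrite delta_mx_lshift /cone_point scale_row_mx add_row_mx scaler0 add0r.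
Qed.

Lemma partial_deriv_radial (f : 'rV[R]_(n + 1) -> R) h r :
  partial_deriv radial f (cone_point h r) =
  'D_1 (fun s : R => f (cone_point h s)) r.
Proof.
apply: derive_along => t; congr f.
rewrite delta_mx_rshift /cone_point scale_row_mx add_row_mx scaler0 add0r.
by congr row_mx; apply/rowP => a; rewrite !mxE !ord1 /=.
Qed.

Variable g : 'rV[R]_n -> 'M[R]_n.

Hypothesis (gT : forall h, (g h)^T = g h).
Hypothesis (gU : forall h, g h \in unitmx).
Hypothesis (gD : forall h i j k,
  derivable (fun q => g q j k) h (delta_mx 0 i)).

Lemma cone_metric_point h r :
  cone_metric g (cone_point h r) = block_mx (r ^+ 2 *: g h) 0 0 1%:M.
Proof. by rewrite /cone_metric /cone_point row_mxKl row_mxKr mxE eqxx. Qed.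

Lemma invmx_cone_metric h r : r != 0 ->
  invmx (cone_metric g (cone_point h r)) =
  block_mx (r ^- 2 *: invmx (g h)) 0 0 1%:M.
Proof.
move=> r0; have r2 : r ^+ 2 \is a GRing.unit by rewrite unitfE expf_neq0.
have cU : r ^+ 2 *: g h \in unitmx by rewrite unitmxZ.
rewrite cone_metric_point invmx_block_diag ?block_diag_mx_unit ?cU ?unitmx1 //.
by rewrite invmx1 invmxZ.
Qed.

Let metric_entries := (block_mxEul, block_mxEur, block_mxEdl, block_mxEdr, mxE).

Lemma partial_cone_metric_base h r i j k :
  partial_deriv (lshift 1 i)
    (fun q => cone_metric g q (lshift 1 j) (lshift 1 k)) (cone_point h r) =
  r ^+ 2 * partial_deriv i (fun q => g q j k) h.
Proof.
rewrite partial_deriv_base.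
under eq_fun do rewrite cone_metric_point !metric_entries.
exact: deriveZ.
Qed.

Lemma partial_cone_metric_radial h r j k :
  partial_deriv radial
    (fun q => cone_metric g q (lshift 1 j) (lshift 1 k)) (cone_point h r) =
  2 * r * g h j k.
Proof.
rewrite partial_deriv_radial.
under eq_fun do rewrite cone_metric_point !metric_entries mulrC.
rewrite [LHS](deriveZ (f := fun s : R => s ^+ 2)); last exact: ex_derive.
rewrite exp_derive /= expr1 /GRing.scale /= mulr1; ring.
Qed.

Lemma partial_cone_metric_mixed h r (c : 'I_(n + 1)) :
  (forall j, partial_deriv c
    (fun q => cone_metric g q (lshift 1 j) radial) (cone_point h r) = 0) *
  (forall j, partial_deriv c
    (fun q => cone_metric g q radial (lshift 1 j)) (cone_point h r) = 0) *
  (partial_deriv c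
    (fun q => cone_metric g q radial radial) (cone_point h r) = 0).
Proof.
by do ![split] => *; apply: partial_deriv_cst => q;
   rewrite /cone_metric !metric_entries.
Qed.

Let partial_cone_metric := (partial_cone_metric_mixed, partial_cone_metric_base,
  partial_cone_metric_radial).

Let metric_sym h i j : g h i j = g h j i.
Proof. by rewrite -[in LHS]gT mxE. Qed.

Lemma cone_metricT q : (cone_metric g q)^T = cone_metric g q.
Proof. by rewrite /cone_metric tr_block_mx !trmx0 trmx1 linearZ /= gT. Qed.

Section Christoffel.
Variables (h : 'rV[R]_n) (r : R).
Hypothesis r0 : r != 0.
Notation Gamma :=
  (fun a b c => christoffel (cone_metric g) a b c (cone_point h r)).

Lemma christoffel_cone_base k i j :
  Gamma (lshift 1 k) (lshift 1 i) (lshift 1 j) = christoffel g k i j h.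
Proof.
rewrite /christoffel invmx_cone_metric // big_split_ord big_ord1 /=.
rewrite !metric_entries mul0r addr0; congr (_ * _); apply: eq_bigr => l _.
rewrite !metric_entries !partial_cone_metric -mulrDr -mulrBr mulrACA.
by rewrite mulVf ?mul1r // expf_neq0.
Qed.

(** The level sets of [r] are umbilic: their second fundamental form is a
    multiple of the metric.  This is the source of the sphere term in the
    curvature of the cone. *)
Lemma christoffel_cone_second_form i j :
  Gamma radial (lshift 1 i) (lshift 1 j) = - (r * g h i j).
Proof.
rewrite /christoffel invmx_cone_metric // big_split_ord big_ord1 /=.
rewrite !metric_entries big1 => [|l _]; last by rewrite !metric_entries mul0r.
by rewrite !partial_cone_metric /=; field.
Qed.

Lemma christoffel_cone_mixed k i :
  Gamma (lshift 1 k) (lshift 1 i) radial = (k == i)%:R / r.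
Proof.
rewrite /christoffel invmx_cone_metric // big_split_ord big_ord1 /=.
rewrite !metric_entries mul0r addr0.
have -> : (k == i)%:R = \sum_l invmx (g h) k l * g h l i.
  by have := mulVmx (gU h) => /matrixP /(_ k i); rewrite !mxE.
rewrite mulr_suml mulr_sumr; apply: eq_bigr => l _.
rewrite !metric_entries !partial_cone_metric (metric_sym _ l).
by field.
Qed.

Lemma christoffel_cone_radial (a : 'I_(n + 1)) : Gamma a radial radial = 0.
Proof.
rewrite /christoffel big1 ?mulr0 // => b _.
case: (cone_indexP b) => [|[j]] ->; rewrite !partial_cone_metric;
  by rewrite !addr0 subr0 mulr0.
Qed.

Lemma christoffel_cone_geodesic i : Gamma radial (lshift 1 i) radial = 0.
Proof.
rewrite /christoffel invmx_cone_metric // big_split_ord big_ord1 /=.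
rewrite !metric_entries big1 => [|l _]; last by rewrite !metric_entries mul0r.
by rewrite !partial_cone_metric /=; field.
Qed.

Let GammaC a b c : Gamma a b c = Gamma a c b :=
  christoffelC _ a b c _ cone_metricT.

Definition christoffel_cone := (christoffel_cone_base,
  christoffel_cone_second_form, christoffel_cone_mixed,
  christoffel_cone_radial, christoffel_cone_geodesic,
  fun k i => etrans (GammaC _ _ _) (christoffel_cone_mixed k i),
  fun i => etrans (GammaC _ _ _) (christoffel_cone_geodesic i)).

End Christoffel.

Section Curvature.
Variables (h : 'rV[R]_n) (r : R).
Hypothesis r0 : r != 0.
Let p := cone_point h r.
Let G := cone_metric g.

Let christoffelE := christoffel_cone h r r0.

Lemma partial_deriv_cone_eq (f f' : 'rV[R]_(n + 1) -> R) a :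
  (forall h' s, s != 0 -> f (cone_point h' s) = f' (cone_point h' s)) ->
  partial_deriv a f p = partial_deriv a f' p.
Proof.
move=> ff'; case: (cone_indexP a) => [|[i]] ->.
  by rewrite !partial_deriv_radial; apply: derive_off_zero => // s; apply: ff'.
by rewrite !partial_deriv_base; apply: partial_deriv_eq => h'; apply: ff'.
Qed.

Lemma partial_christoffel_base l j k :
  (forall i, partial_deriv (lshift 1 i)
    (christoffel G (lshift 1 l) (lshift 1 j) (lshift 1 k)) p =
    partial_deriv i (christoffel g l j k) h) *
  (partial_deriv radial
    (christoffel G (lshift 1 l) (lshift 1 j) (lshift 1 k)) p = 0).
Proof.
have pullback a : partial_deriv a
    (christoffel G (lshift 1 l) (lshift 1 j) (lshift 1 k)) p =
    partial_deriv a (fun q => christoffel g l j k (lsubmx q)) p.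
  apply: partial_deriv_cone_eq => h' s s0.
  by rewrite christoffel_cone // /cone_point row_mxKl.
split=> [i|]; rewrite pullback ?partial_deriv_base ?partial_deriv_radial.
  by apply: partial_deriv_eq => h'; rewrite /cone_point row_mxKl.
by under eq_fun do rewrite /cone_point row_mxKl; exact: derive_cst.
Qed.

Lemma partial_christoffel_second_form j k :
  (forall i, partial_deriv (lshift 1 i)
    (christoffel G radial (lshift 1 j) (lshift 1 k)) p =
    - (r * partial_deriv i (fun q => g q j k) h)) *
  (partial_deriv radial
    (christoffel G radial (lshift 1 j) (lshift 1 k)) p = - g h j k).
Proof.
split=> [i|].
  rewrite partial_deriv_base -mulNr.
  under eq_fun do rewrite christoffel_cone // -mulNr.
  exact: deriveZ.
rewrite partial_deriv_radial (derive_off_zero _ (fun s => - g h j k * s)) //.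
  by rewrite [LHS](deriveZ (f := id)) // derive_id /GRing.scale /= mulr1.
by move=> s s0; rewrite christoffel_cone // mulNr mulrC.
Qed.

Lemma partial_christoffel_mixed l j :
  (forall i, partial_deriv (lshift 1 i)
    (christoffel G (lshift 1 l) (lshift 1 j) radial) p = 0) *
  (partial_deriv radial
    (christoffel G (lshift 1 l) (lshift 1 j) radial) p =
   - (l == j)%:R / r ^+ 2).
Proof.
split=> [i|].
  rewrite partial_deriv_base; under eq_fun do rewrite christoffel_cone //.
  exact: derive_cst.
rewrite partial_deriv_radial.
rewrite (derive_off_zero _ (fun s => (l == j)%:R * s^-1)) //.
  rewrite [LHS](deriveZ (f := fun s : R => s^-1)); last exact: derivableV.
  by rewrite deriveV // derive_id /GRing.scale /= mulr1 mulrN mulNr.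
by move=> s s0; rewrite christoffel_cone.
Qed.

Lemma partial_christoffel_radial (b : 'I_(n + 1)) :
  (forall a, partial_deriv b (christoffel G a radial radial) p = 0) *
  (forall j, partial_deriv b (christoffel G radial (lshift 1 j) radial) p = 0).
Proof.
by split=> [a|j];
  rewrite (partial_deriv_cone_eq _ (fun=> 0)) ?partial_deriv_cst //
  => h' s s0; rewrite christoffel_cone.
Qed.

Lemma partial_christoffelC (a b c d : 'I_(n + 1)) :
  partial_deriv a (christoffel G b c d) p =
  partial_deriv a (christoffel G b d c) p.
Proof. by apply: partial_deriv_eq => q; apply: christoffelC cone_metricT. Qed.

Let partial_christoffel := (partial_christoffel_base,
  partial_christoffel_second_form, partial_christoffel_mixed,
  partial_christoffel_radial).

(** The correction is the curvature tensor of constant curvature [1]; it is the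
    product of the second fundamental form [- r g] with its shape operator
    [1 / r], the path through the radial index in the quadratic terms. *)
Lemma riemann_cone_base l k i j :
  riemann_coef G (lshift 1 l) (lshift 1 k) (lshift 1 i) (lshift 1 j) p =
  riemann_coef g l k i j h
  - (g h j k * (l == i)%:R - g h i k * (l == j)%:R).
Proof.
rewrite /riemann_coef big_split_ord big_ord1 /= !partial_christoffel.
rewrite !christoffelE addrA; congr (_ + _ + _); last by field.
by apply: eq_bigr => m _; rewrite !christoffelE.
Qed.

Let sum_deltar (F : 'I_n -> R) j :
  \sum_m F m * ((m == j)%:R / r) = F j / r.
Proof.
rewrite (bigD1 j) //= eqxx mul1r big1 ?addr0 // => m /negPf ->.
by rewrite mul0r mulr0.
Qed.

Let sum_deltal (F : 'I_n -> R) j :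
  \sum_m (j == m)%:R / r * F m = F j / r.
Proof.
rewrite -sum_deltar; apply: eq_bigr => m _; rewrite mulrC.
by rewrite eq_sym.
Qed.

(** Lowering the index recovers the Christoffel symbols of the first kind, which
    involve only first derivatives of the metric. *)
Lemma christoffel_lower i j k :
  \sum_m g h i m * christoffel g m j k h =
  2^-1 * (partial_deriv j (fun q => g q k i) h
          + partial_deriv k (fun q => g q j i) h
          - partial_deriv i (fun q => g q j k) h).
Proof.
rewrite /christoffel; under eq_bigr do rewrite mulrCA mulr_sumr.
rewrite -mulr_sumr exchange_big /=; congr (_ * _).
under eq_bigr => l _.
  under eq_bigr do rewrite mulrA.
  rewrite -mulr_suml.
  have -> : \sum_m g h i m * invmx (g h) m l = (i == l)%:R.
    by have := mulmxV (gU h) => /matrixP /(_ i l); rewrite !mxE.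
  over.
rewrite (bigD1 i) //= eqxx mul1r big1 ?addr0 // => l.
by rewrite eq_sym => /negPf ->; rewrite mul0r.
Qed.

(** The mixed components vanish because the rays are geodesics along which the
    frame only gets rescaled.  The components whose upper index alone is radial
    are the Codazzi equation for the second fundamental form [- r g]: they
    vanish since [g] is parallel for its own connection. *)
Lemma riemann_cone_radial (a b c d : 'I_(n + 1)) :
  radial \in [:: a; b; c; d] -> riemann_coef G a b c d p = 0.
Proof.
have vertical e f i : riemann_coef G e f (lshift 1 i) radial p = 0.
  rewrite /riemann_coef big_split_ord big_ord1 /= sumrB.
  case: (cone_indexP e) (cone_indexP f) => [|[l]] -> [|[k]] ->.
  - rewrite !partial_christoffel !christoffelE.
    by rewrite !big1 ?mulr0 => [|m _|m _]; rewrite ?christoffelE ?mulr0; ring.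
  - rewrite (partial_christoffelC _ _ radial) !partial_christoffel.
    rewrite !christoffelE.
    under eq_bigr do rewrite !christoffelE.
    rewrite sum_deltar big1 => [|m _]; last by rewrite !christoffelE mul0r.
    by field.
  - rewrite !partial_christoffel !christoffelE.
    rewrite big1 => [|m _]; last by rewrite !christoffelE mulr0.
    under eq_bigr do rewrite !christoffelE.
    by rewrite sum_deltal; field.
  - rewrite (partial_christoffelC _ _ radial) !partial_christoffel.
    rewrite !christoffelE.
    under eq_bigr do rewrite !christoffelE.
    rewrite sum_deltar; under eq_bigr do rewrite !christoffelE.
    by rewrite sum_deltal; ring.
case: (cone_indexP c) (cone_indexP d) => [|[i]] -> [|[j]] -> //.
- move=> _; have := riemann_coefC G a b radial radial p.
  by move/eqP; rewrite -subr_eq0 opprK -mulr2n mulrn_eq0 => /eqP.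
- by move=> _; rewrite riemann_coefC vertical oppr0.
rewrite /riemann_coef big_split_ord big_ord1 /= sumrB.
case: (cone_indexP a) (cone_indexP b) => [|[l]] -> [|[k]] -> abr.
- rewrite !partial_christoffel ?christoffelE.
  under eq_bigr do rewrite !christoffelE.
  rewrite sum_deltar; under eq_bigr do rewrite !christoffelE.
  by rewrite sum_deltar (metric_sym _ j); ring.
- rewrite !partial_christoffel !christoffelE.
  have lower i' j' : \sum_m christoffel G radial (lshift 1 i') (lshift 1 m) p *
      christoffel G (lshift 1 m) (lshift 1 j') (lshift 1 k) p =
      - (r * \sum_m g h i' m * christoffel g m j' k h).
    rewrite mulr_sumr -sumrN; apply: eq_bigr => m _.
    by rewrite !christoffelE mulNr mulrA.
  (* Up to the symmetry of [g], the first-kind symbols cancel the two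
     derivatives of the second fundamental form. *)
  rewrite !lower !christoffel_lower.
  have sym a1 b1 c1 : partial_deriv a1 (fun q => g q b1 c1) h =
      partial_deriv a1 (fun q => g q c1 b1) h.
    by apply: partial_deriv_eq => q.
  rewrite (sym _ k i) (sym _ k j) (sym _ j i).
  set A := partial_deriv i _ h; set B := partial_deriv j _ h.
  set C := partial_deriv k _ h.
  by field.
- rewrite !partial_christoffel !christoffelE.
  under eq_bigr do rewrite !christoffelE.
  rewrite sum_deltar; under eq_bigr do rewrite !christoffelE.
  by rewrite sum_deltar christoffelC //; ring.
by move: abr; rewrite !inE !eq_rlshift.
Qed.

Lemma inner_cone u (V : 'rV[R]_(n + 1)) :
  inner G p (row_mx u 0) V = r ^+ 2 * inner g h u (lsubmx V).
Proof.
rewrite /inner /G cone_metric_point mul_row_block !mul0mx !mulmx0 !addr0.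
rewrite -[V in LHS]hsubmxK tr_row_mx mul_row_col mul0mx addr0.
by rewrite -scalemxAr -scalemxAl mxE.
Qed.

Lemma riemann_cone (U V W : 'rV[R]_(n + 1)) :
  let u := lsubmx U in let v := lsubmx V in let w := lsubmx W in
  riemann G p U V W =
  row_mx (riemann g h u v w - (inner g h v w *: u - inner g h u w *: v)) 0.
Proof.
move=> u v w; apply/rowP => a; rewrite mxE.
have all_base : \sum_i \sum_j \sum_k
      U 0 i * V 0 j * W 0 k * riemann_coef G a k i j p =
    \sum_i \sum_j \sum_k u 0 i * v 0 j * w 0 k *
      riemann_coef G a (lshift 1 k) (lshift 1 i) (lshift 1 j) p.
  rewrite big_split_ord big_ord1 /=.
  rewrite [X in _ + X = _]big1 ?addr0 => [|j _]; last first.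
    apply: big1 => k _.
    by rewrite riemann_cone_radial ?mulr0 // !inE eqxx !orbT.
  apply: eq_bigr => i _.
  rewrite big_split_ord big_ord1 /=.
  rewrite [X in _ + X = _]big1 ?addr0 => [|k _]; last first.
    by rewrite riemann_cone_radial ?mulr0 // !inE eqxx !orbT.
  apply: eq_bigr => j _.
  rewrite big_split_ord big_ord1 /=.
  rewrite riemann_cone_radial ?mulr0 ?addr0; last first.
    by rewrite !inE eqxx !orbT.
  by apply: eq_bigr => k _; rewrite !mxE.
rewrite all_base {all_base}; clearbody u v w.
case: (split_ordP a) => l ->; last first.
  rewrite row_mxEr mxE !big1 // => i _; rewrite big1 // => j _.
  rewrite big1 // => k _; rewrite riemann_cone_radial ?mulr0 //.
  by rewrite !inE (ord1 l) eqxx.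
rewrite row_mxEl !mxE !innerE.
(* Expanding [u 0 l] as a Kronecker sum gives both sides the same triple sum. *)
have pick (x : 'rV[R]_n) : x 0 l = \sum_i x 0 i * (l == i)%:R.
  rewrite (bigD1 l) //= eqxx mulr1 big1 ?addr0 // => i.
  by rewrite eq_sym => /negPf ->; rewrite mulr0.
rewrite [u 0 l]pick [v 0 l]pick.
have -> : (\sum_i \sum_j v 0 i * w 0 j * g h i j) *
      (\sum_i u 0 i * (l == i)%:R) =
    \sum_i \sum_j \sum_k v 0 j * w 0 k * g h j k * (u 0 i * (l == i)%:R).
  rewrite mulr_sumr; apply: eq_bigr => i _.
  rewrite mulr_suml; apply: eq_bigr => j _.
  by rewrite mulr_suml.
have -> : (\sum_i \sum_j u 0 i * w 0 j * g h i j) *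
      (\sum_i v 0 i * (l == i)%:R) =
    \sum_i \sum_j \sum_k u 0 i * w 0 k * g h i k * (v 0 j * (l == j)%:R).
  rewrite mulr_suml; apply: eq_bigr => i _.
  rewrite mulr_sumr; apply: eq_bigr => j _.
  by rewrite mulr_suml.
do 3 (rewrite -!sumrB; apply: eq_bigr => ? _).
by rewrite riemann_cone_base; ring.
Qed.

(** Gauss type formula: the cone is as curved as the base is in excess of the
    unit sphere. *)
Lemma riemann_cone_quartic (U V : 'rV[R]_(n + 1)) :
  let u := lsubmx U in let v := lsubmx V in
  inner G p (riemann G p U V V) U =
  r ^+ 2 * (inner g h (riemann g h u v v) u
            - (inner g h u u * inner g h v v - inner g h u v ^+ 2)).
Proof.
move=> u v; rewrite riemann_cone inner_cone -/u -/v; congr (_ * _).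
by rewrite !innerBl !innerZl (innerC g h v u (gT h)); ring.
Qed.

End Curvature.

Definition cone_frame (f : 'M[R]_n) r : 'M[R]_(n + 1) :=
  block_mx (r^-1 *: f) 0 0 1%:M.

Lemma row_cone_base f r i :
  row (lshift 1 i) (cone_frame f r) = row_mx (r^-1 *: row i f) 0.
Proof. by rewrite rowKu row_row_mx linearZ /= row0. Qed.

Lemma row_cone_radial f r :
  row radial (cone_frame f r) = row_mx 0 1%:M.
Proof.
by rewrite rowKd row_row_mx row0; congr row_mx; apply/rowP => i; rewrite !mxE.
Qed.

Lemma cone_frame_orthonormal h r f : r != 0 ->
  orthonormal_basis g h f ->
  orthonormal_basis (cone_metric g) (cone_point h r) (cone_frame f r).
Proof.
move=> r0 /orthonormal_basisP f_on; apply/orthonormal_basisP.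
rewrite cone_metric_point tr_block_mx !trmx0 trmx1 linearZ /= !mulmx_block.
rewrite !mul0mx !mulmx0 !mulmx1 !addr0 !add0r !mul0mx.
rewrite -!scalemxAr -!scalemxAl f_on !scalerA.
have -> : r^-1 * r ^+ 2 * r^-1 = 1 by field.
by rewrite scale1r -scalar_mx_block.
Qed.

End Cone.

(** * Curvature of the Heisenberg group *)

Section HeisenbergGroup.
Context {R : realType}.
Implicit Types (h p u v w : 'rV[R]_3) (i j k l : 'I_3).

Lemma sum3 (V : nmodType) (F : 'I_3 -> V) :
  \sum_i F i = F (inord 0) + F (inord 1) + F (inord 2).
Proof.
rewrite !big_ord_recr big_ord0 /= add0r.
by congr (F _ + F _ + F _); apply: val_inj; rewrite /= inordK.
Qed.

Lemma eq_inord3 (a b : nat) : (a < 3)%N -> (b < 3)%N ->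
  (inord a == inord b :> 'I_3) = (a == b).
Proof. by move=> a3 b3; rewrite -val_eqE /= !inordK. Qed.

(** Along coordinate lines [omega], [X] and [Y] are affine, so their products
    are quadratic and every derivative below is read off a polynomial
    identity. *)
Lemma is_derive_quadratic (f : 'rV[R]_3 -> R) p v (c d : R) :
  (forall s : R, f (s *: v + p) = f p + s * (c + s * d)) -> is_derive p v f c.
Proof.
move=> fE.
have affine : (c + s * d @[s --> (0 : R)^'] --> c + 0 * d)%classic.
  apply: cvgD; first exact: cvg_cst.
  by apply: cvgMl; apply: nbhs_dnbhs.
have quotient :
    (s^-1 *: ((f \o shift p) (s *: v) - f p) @[s --> 0^'] --> c)%classic.
  rewrite mul0r addr0 in affine; apply: cvg_trans affine.
  apply: near_eq_cvg; near=> s.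
  rewrite /= fE [f p + _]addrC addrK /GRing.scale /= mulKf //.
  by near: s; exact: nbhs_dnbhs_neq.
by split; [apply/cvg_ex; exists c | apply/cvg_lim].
Unshelve. all: by end_near. Qed.

Lemma ord3P i : [\/ i = inord 0, i = inord 1 | i = inord 2].
Proof.
case: i => [[|[|[|//]]]] i3; [constructor 1|constructor 2|constructor 3];
  by apply: val_inj; rewrite /= inordK.
Qed.

Lemma dx_coord :
  (dx 0 (inord 0) = 1 :> R) * (dx 0 (inord 1) = 0 :> R) *
  (dx 0 (inord 2) = 0 :> R).
Proof. by rewrite /dx !mxE !eq_inord3. Qed.

Lemma dy_coord :
  (dy 0 (inord 0) = 0 :> R) * (dy 0 (inord 1) = 1 :> R) *
  (dy 0 (inord 2) = 0 :> R).
Proof. by rewrite /dy !mxE !eq_inord3. Qed.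

Lemma dt_coord :
  (dt 0 (inord 0) = 0 :> R) * (dt 0 (inord 1) = 0 :> R) *
  (dt 0 (inord 2) = 1 :> R).
Proof. by rewrite /dt !mxE !eq_inord3. Qed.

Let coords := (dx_coord, dy_coord, dt_coord).

(** With the Kronecker symbol written in this way, identities between tensors
    become polynomial identities in the values of the covectors, and need no
    case analysis on free indices. *)
Lemma coordinate_frame i j :
  (i == j)%:R = dx 0 i * dx 0 j + dy 0 i * dy 0 j + dt 0 i * dt 0 j :> R.
Proof.
by case: (ord3P i) (ord3P j) => -> [] ->; rewrite eq_inord3 // !coords /=; ring.
Qed.

Lemma omegaE h i :
  omega h 0 i = dt 0 i + 2 * cx h * dy 0 i - 2 * cy h * dx 0 i.
Proof. by rewrite !mxE. Qed.

Lemma XE h i : X h 0 i = dx 0 i + 2 * cy h * dt 0 i.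
Proof. by rewrite !mxE. Qed.

Lemma YE h i : Y h 0 i = dy 0 i - 2 * cx h * dt 0 i.
Proof. by rewrite !mxE. Qed.

Let frames := (omegaE, XE, YE).

Lemma heis_metricE h i j : heis_metric h i j =
  dx 0 i * dx 0 j + dy 0 i * dy 0 j + 4^-1 * (omega h 0 i * omega h 0 j).
Proof. by rewrite /heis_metric /covector_sq !mxE !big_ord1 !mxE. Qed.

Lemma heis_metricT h : (heis_metric h)^T = heis_metric h.
Proof. by apply/matrixP => i j; rewrite mxE !heis_metricE; ring. Qed.

(** The inverse metric is the sum of the squares of the orthonormal frame
    [X], [Y], [2T]. *)
Definition heis_cometric h : 'M[R]_3 :=
  \matrix_(i, j)
    (X h 0 i * X h 0 j + Y h 0 i * Y h 0 j + 4 * (dt 0 i * dt 0 j)).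

Lemma heis_cometricE h i j : heis_cometric h i j =
  X h 0 i * X h 0 j + Y h 0 i * Y h 0 j + 4 * (dt 0 i * dt 0 j).
Proof. by rewrite mxE. Qed.

Lemma heis_metricV h : heis_metric h *m heis_cometric h = 1%:M.
Proof.
apply/matrixP => i j; rewrite !mxE coordinate_frame.
under eq_bigr do rewrite heis_metricE heis_cometricE.
by rewrite sum3 !frames !coords; field.
Qed.

Lemma heis_metric_unit h : heis_metric h \in unitmx.
Proof. by have [] := mulmx1_unit (heis_metricV h). Qed.

Lemma invmx_heis_metric h : invmx (heis_metric h) = heis_cometric h.
Proof.
rewrite -[LHS]mulmx1 -(heis_metricV h) mulmxA.
by rewrite mulVmx ?mul1mx ?heis_metric_unit.
Qed.

(** The coordinate derivative [d_i omega_j].  It is antisymmetric, hence half of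
    the exterior derivative of [omega], and constant. *)
Definition domega i j : R := 2 * (dx 0 i * dy 0 j - dy 0 i * dx 0 j).

Let cx_line p i s : cx (s *: delta_mx 0 i + p) = cx p + s * dx 0 i.
Proof. by rewrite /cx /dx !mxE /= addrC [_ == i]eq_sym. Qed.

Let cy_line p i s : cy (s *: delta_mx 0 i + p) = cy p + s * dy 0 i.
Proof. by rewrite /cy /dy !mxE /= addrC [_ == i]eq_sym. Qed.

Let lines := (cx_line, cy_line).

Lemma is_derive_heis_metric h i j k :
  is_derive h (delta_mx 0 i) (fun q => heis_metric q j k)
    (4^-1 * (domega i j * omega h 0 k + omega h 0 j * domega i k)).
Proof.
apply: (@is_derive_quadratic _ _ _ _ (4^-1 * (domega i j * domega i k))) => s.
by rewrite !heis_metricE !frames !lines /domega; field.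
Qed.

Lemma heis_metric_derivable h i j k :
  derivable (fun q => heis_metric q j k) h (delta_mx 0 i).
Proof. by have [] := is_derive_heis_metric h i j k. Qed.

(** [domega] with its second index raised: the endomorphism [d_x -> 2Y],
    [d_y -> - 2X], [d_t -> 0], twice the rotation of the horizontal plane. *)
Definition rotation h i k : R := 2 * (dx 0 i * Y h 0 k - dy 0 i * X h 0 k).

(** Antisymmetry of [domega] cancels the terms of the Koszul formula in which
    the raised index falls on [omega]. *)
Lemma christoffel_heis h k i j :
  christoffel (@heis_metric R) k i j h =
  4^-1 * (omega h 0 i * rotation h j k + omega h 0 j * rotation h i k).
Proof.
have partialE a b c : partial_deriv a (fun q => heis_metric q b c) h =
    4^-1 * (domega a b * omega h 0 c + omega h 0 b * domega a c).
  by have [] := is_derive_heis_metric h a b c.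
rewrite /christoffel invmx_heis_metric.
under eq_bigr do rewrite !partialE heis_cometricE.
by rewrite sum3 /rotation /domega !frames !coords; field.
Qed.

(** The derivative of [rotation] in the direction [d_a] sends [d_j] to
    [- 4 (dx_a dx_j + dy_a dy_j) d_t], because the [d_t] components of [X] and
    [Y] are linear in the coordinates. *)
Lemma partial_christoffel_heis h a k i j :
  partial_deriv a (christoffel (@heis_metric R) k i j) h =
  4^-1 * (domega a i * rotation h j k + domega a j * rotation h i k)
  - (omega h 0 i * (dx 0 a * dx 0 j + dy 0 a * dy 0 j)
     + omega h 0 j * (dx 0 a * dx 0 i + dy 0 a * dy 0 i)) * dt 0 k.
Proof.
set D := RHS; suff [] : is_derive h (delta_mx 0 a : 'rV[R]_3)
  (christoffel (@heis_metric R) k i j) D by [].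
rewrite /D; apply: (@is_derive_quadratic _ _ _ _
  (- (domega a i * (dx 0 a * dx 0 j + dy 0 a * dy 0 j)
     + domega a j * (dx 0 a * dx 0 i + dy 0 a * dy 0 i)) * dt 0 k)) => s.
by rewrite !christoffel_heis /rotation !frames !lines /domega; field.
Qed.

Definition omega_at h u : R := (u *m (omega h)^T) 0 0.

Let omega_atE h u : omega_at h u =
  u 0 (inord 2) + 2 * cx h * cy u - 2 * cy h * cx u.
Proof.
rewrite /omega_at mxE; under eq_bigr do rewrite [_^T _ _]mxE.
by rewrite sum3 !frames !coords /cx /cy; ring.
Qed.

Lemma omega_at_sum h u : omega_at h u = \sum_i u 0 i * omega h 0 i.
Proof. by rewrite /omega_at mxE; under eq_bigr do rewrite [_^T _ _]mxE. Qed.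

Lemma cx_sum u : cx u = \sum_i u 0 i * dx 0 i.
Proof. by rewrite sum3 !coords /cx; ring. Qed.

Lemma cy_sum u : cy u = \sum_i u 0 i * dy 0 i.
Proof. by rewrite sum3 !coords /cy; ring. Qed.

(** The component [l] of [R(u,v)w], as a function of the values of
    [(dx, dy, omega)] on [u] (unprimed), [v] (one prime) and [w] (two primes).
    Being multilinear in the three slots, the same expression serves for
    coordinate fields and for arbitrary vectors. *)
Definition curvature_component h l (a b o a' b' o' a'' b'' o'' : R) : R :=
  2 * (a * b' - b * a') * (a'' * Y h 0 l - b'' * X h 0 l)
  + (a * b'' - b * a'') * (a' * Y h 0 l - b' * X h 0 l)
  - (a' * b'' - b' * a'') * (a * Y h 0 l - b * X h 0 l)
  - (o' * (a * a'' + b * b'') - o * (a' * a'' + b' * b'')) * dt 0 l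
  - 4^-1 * o'' * (o * (a' * X h 0 l + b' * Y h 0 l)
                  - o' * (a * X h 0 l + b * Y h 0 l)).

Lemma riemann_coef_heis h l k i j :
  riemann_coef (@heis_metric R) l k i j h =
  curvature_component h l (dx 0 i) (dy 0 i) (omega h 0 i)
    (dx 0 j) (dy 0 j) (omega h 0 j) (dx 0 k) (dy 0 k) (omega h 0 k).
Proof.
rewrite /riemann_coef !partial_christoffel_heis /curvature_component.
under eq_bigr do rewrite !christoffel_heis.
by rewrite sum3 /rotation /domega !frames !coords; field.
Qed.

(** The slots are contracted one after the other, by linearity in each. *)
Lemma riemann_heis h u v w l :
  riemann (@heis_metric R) h u v w 0 l =
  curvature_component h l (cx u) (cy u) (omega_at h u)
    (cx v) (cy v) (omega_at h v) (cx w) (cy w) (omega_at h w).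
Proof.
rewrite mxE !cx_sum !cy_sum !omega_at_sum /curvature_component.
under eq_bigr => i _.
  under eq_bigr => j _.
    under eq_bigr do rewrite riemann_coef_heis -mulrA /curvature_component.
    rewrite -mulr_sumr -mulrA.
    rewrite [X in _ * (_ * X)](_ : _ = curvature_component h l
      (dx 0 i) (dy 0 i) (omega h 0 i) (dx 0 j) (dy 0 j) (omega h 0 j)
      (\sum_k w 0 k * dx 0 k) (\sum_k w 0 k * dy 0 k)
      (\sum_k w 0 k * omega h 0 k)); last first.
      rewrite /curvature_component !sum3; ring.
    over.
  rewrite -mulr_sumr.
  rewrite [X in _ * X](_ : _ = curvature_component h l
      (dx 0 i) (dy 0 i) (omega h 0 i)
      (\sum_k v 0 k * dx 0 k) (\sum_k v 0 k * dy 0 k)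
      (\sum_k v 0 k * omega h 0 k)
      (\sum_k w 0 k * dx 0 k) (\sum_k w 0 k * dy 0 k)
      (\sum_k w 0 k * omega h 0 k)); last first.
    rewrite /curvature_component [LHS]sum3 ![\sum_k v 0 k * _]sum3; ring.
  over.
rewrite /curvature_component [LHS]sum3 ![\sum_k u 0 k * _]sum3; ring.
Qed.

Lemma inner_heis h u v : inner (@heis_metric R) h u v =
  cx u * cx v + cy u * cy v + 4^-1 * (omega_at h u * omega_at h v).
Proof.
rewrite innerE !sum3 !heis_metricE !omega_atE !frames !coords /cx /cy.
by field.
Qed.

(** In the orthonormal coframe [dx], [dy], [omega / 2] the right-hand side is
    [- 3 A^2 + B^2 + C^2], where [A], [B], [C] are the areas of the projections
    of [u], [v] to the coordinate planes: the curvature operator is diagonal,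
    with eigenvalue [-3] on the horizontal plane and [1] on the two others. *)
Lemma riemann_heis_quartic h u v :
  inner (@heis_metric R) h (riemann (@heis_metric R) h u v v) u =
  - 3 * (cx u * cy v - cy u * cx v) ^+ 2
  + 4^-1 * ((omega_at h u * cx v - omega_at h v * cx u) ^+ 2
            + (omega_at h u * cy v - omega_at h v * cy u) ^+ 2).
Proof.
rewrite inner_heis (cx_sum (riemann _ _ _ _ _)) (cy_sum (riemann _ _ _ _ _)).
rewrite (omega_at_sum _ (riemann _ _ _ _ _)) !sum3 !riemann_heis.
rewrite /curvature_component !frames !coords; by field.
Qed.

(** Every plane containing the vertical direction has the curvature of the unit
    sphere, so the excess over the sphere is purely horizontal. *)
Lemma riemann_heis_deviation h u v :
  inner (@heis_metric R) h (riemann (@heis_metric R) h u v v) u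
  - (inner (@heis_metric R) h u u * inner (@heis_metric R) h v v
     - inner (@heis_metric R) h u v ^+ 2) =
  - 4 * (cx u * cy v - cy u * cx v) ^+ 2.
Proof. by rewrite riemann_heis_quartic !inner_heis; field. Qed.

End HeisenbergGroup.

(** * The cone over the Heisenberg group *)

Section ConeOverHeisenberg.
Context {R : realType}.
Implicit Types (h : 'rV[R]_3) (r : R).

Definition heis_frame h : 'M[R]_3 :=
  \matrix_(i < 3) nth 0 [:: X h; Y h; Ttilde h] i.

Let frame_rows h :
  (row (inord 0) (heis_frame h) = X h) * (row (inord 1) (heis_frame h) = Y h) *
  (row (inord 2) (heis_frame h) = Ttilde h).
Proof. by rewrite !rowK !inordK. Qed.

Let frame_coords h :
  (cx (X h) = 1) * (cy (X h) = 0) * (omega_at h (X h) = 0) *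
  (cx (Y h) = 0) * (cy (Y h) = 1) * (omega_at h (Y h) = 0) *
  (cx (Ttilde h) = 0) * (cy (Ttilde h) = 0) * (omega_at h (Ttilde h) = 2).
Proof.
rewrite !omega_at_sum /cx /cy !sum3 !omegaE !XE !YE.
rewrite !dx_coord !dy_coord !dt_coord.
have TE i : Ttilde h 0 i = 2 * dt 0 i by rewrite !mxE.
by rewrite !TE !dt_coord; do !split; ring.
Qed.

Lemma heis_frame_orthonormal h :
  orthonormal_basis (@heis_metric R) h (heis_frame h).
Proof.
move=> i j; case: (ord3P i) (ord3P j) => -> [] ->;
  by rewrite !frame_rows inner_heis !frame_coords eq_inord3 //=; field.
Qed.

(** The inner products with [X_r], [Y_r] are [r dx], [r dy], so the squared area
    carries a factor [r^4] against the [r^2] of the cone formula. *)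
Lemma cone_heis_plane h r : r != 0 ->
  curvature_in_plane (cone_metric (@heis_metric R)) (cone_point h r)
    (X_r h r) (Y_r h r) (- 4 / r ^+ 2).
Proof.
move=> r0 U V; rewrite riemann_cone_quartic //; last 3 first.
- exact: heis_metricT.
- exact: heis_metric_unit.
- exact: heis_metric_derivable.
rewrite riemann_heis_deviation.
have coneT q := cone_metricT (@heis_metric R) (@heis_metricT R) q.
have pairX W :
    inner (cone_metric (@heis_metric R)) (cone_point h r) W (X_r h r) =
    r * cx (lsubmx W).
  rewrite innerC // inner_cone innerZl inner_heis !frame_coords.
  by field.
have pairY W :
    inner (cone_metric (@heis_metric R)) (cone_point h r) W (Y_r h r) =
    r * cy (lsubmx W).
  rewrite innerC // inner_cone innerZl inner_heis !frame_coords.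
  by field.
by rewrite !pairX !pairY; field.
Qed.

End ConeOverHeisenberg.

Theorem corollary4p2 (R : realType) (h : 'rV[R]_3) (r : R) (r_gt0 : 0 < r) :
  let g_r := cone_metric (@heis_metric R) in
  let p := cone_point h r in
  [/\ has_ricci g_r p (X_r h r) (- (4 / (3 * r ^+ 2))),
      has_ricci g_r p (Y_r h r) (- (4 / (3 * r ^+ 2))),
      has_ricci g_r p (T_r h r) 0,
      has_ricci g_r p d_r 0
    & has_scalar g_r p (- (2 / (3 * r ^+ 2)))].
Proof.
move=> g_r p; have r0 : r != 0 by rewrite gt_eqF.
pose e := cone_frame (heis_frame h) r.
have gT : (g_r p)^T = g_r p by apply: cone_metricT; exact: heis_metricT.
have e_on : orthonormal_basis g_r p e.
  by apply: cone_frame_orthonormal => //; exact: heis_frame_orthonormal.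
have rowX : row (lshift 1 (inord 0)) e = X_r h r.
  by rewrite row_cone_base rowK inordK.
have rowY : row (lshift 1 (inord 1)) e = Y_r h r.
  by rewrite row_cone_base rowK inordK.
have rowT : row (lshift 1 (inord 2)) e = T_r h r.
  by rewrite row_cone_base rowK inordK.
have rowr : row (rshift 3 ord0) e = d_r by exact: row_cone_radial.
have XY : lshift 1 (inord 0 : 'I_3) != lshift 1 (inord 1).
  by rewrite eq_lshift eq_inord3.
have plane : curvature_in_plane g_r p (row (lshift 1 (inord 0)) e)
    (row (lshift 1 (inord 1)) e) (- 4 / r ^+ 2).
  by rewrite rowX rowY; exact: cone_heis_plane.
have ricci := ricci_of_frame _ _ _ _ _ _ gT e_on XY plane.
split.
- rewrite -rowX; move: (ricci (lshift 1 (inord 0))).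
  by rewrite eqxx; congr has_ricci; rewrite /=; field.
- rewrite -rowY; move: (ricci (lshift 1 (inord 1))).
  by rewrite eqxx orbT; congr has_ricci; rewrite /=; field.
- rewrite -rowT; move: (ricci (lshift 1 (inord 2))).
  by rewrite !eq_lshift !eq_inord3 //= !mulr0.
- rewrite -rowr; move: (ricci (rshift 3 ord0)).
  by rewrite !eq_rlshift /= !mulr0.
have := scalar_of_plane _ _ _ _ _ _ gT e_on XY plane.
by congr has_scalar; rewrite /=; field.
Qed.
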